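(* Let $X$ be a Hausdorff topological space which is either (i) completely regular and separable, or (ii) perfectly normal. Then $X$ is a Baire space if and only if $X$ is weakly Namioka.
   Context: All topological spaces are assumed to be Hausdorff. A function $f:X\times Y\to Z$ between topological spaces is separately continuous if for every $y\in Y$ the restriction $f|_{X\times\{y\}}$ is continuous and for every $x\in X$ the restriction $f|_{\{x\}\times Y}$ is continuous. A (Hausdorff) space $X$ is weakly Namioka if for every second countable (Hausdorff) space $Y$, every metric space $Z$, and every separately continuous function $f:X\times Y\to Z$, there is a dense $G_\delta$ subset $D$ of $X$ such that $f$ is continuous on $D\times Y$, meaning that $f$ is (jointly) continuous, as a function on $X\times Y$ with the product topology, at every point of $D\times Y$. *)

(* Defs.v *)
From mathcomp Require Import all_boot all_order all_algebra.
From mathcomp Require Import all_classical all_reals all_analysis.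
From mathcomp Require Import borel_hierarchy.

Set Implicit Arguments.
Unset Strict Implicit.
Unset Printing Implicit Defensive.

Local Open Scope classical_set_scope.

Definition separable_space (T : topologicalType) : Prop :=
  exists2 A : set T, countable A & dense A.

(* The T1 axiom is not part of [normal_space]; for Hausdorff [T] this is the
   usual notion of a perfectly normal space. *)
Definition perfectly_normal_space (T : topologicalType) : Prop :=
  normal_space T /\ forall A : set T, closed A -> Gdelta A.

Definition baire_space (T : topologicalType) : Prop :=
  forall F : (set T)^nat,
    (forall i, open (F i) /\ dense (F i)) -> dense (\bigcap_i F i).

Definition separately_continuous (X Y Z : topologicalType) (f : X * Y -> Z) :
    Prop :=
  (forall y : Y, continuous (fun x : X => f (x, y))) /\
  (forall x : X, continuous (fun y : Y => f (x, y))).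

Definition weakly_namioka (R : realType) (X : topologicalType) : Prop :=
  forall (Y : topologicalType) (Z : metricType R) (f : X * Y -> Z),
    hausdorff_space Y -> @second_countable Y -> separately_continuous f ->
    exists D : set X, [/\ dense D, Gdelta D &
      forall (x : X) (y : Y), D x -> {for (x, y), continuous f}].

(* Main.v *)
Require Import Defs.
From mathcomp Require Import all_boot all_order all_algebra.
From mathcomp Require Import all_classical all_reals all_analysis.
From mathcomp Require Import borel_hierarchy.
From mathcomp Require Import ring lra.

(** Baire implies weakly Namioka, for an arbitrary space [X].  Let [f] be
separately continuous on [X * Y] and [B] a countable basis of [Y].  For [U] in
[B] and [n], the set of the [x] such that [f (x, -)] oscillates by at most
[1/(n+1)] on [U] is closed, because [f] is continuous in [x]
([closed_small_oscillation]), so its boundary is closed and nowhere dense.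
There are countably many such boundaries, and by the Baire property they miss a
dense G-delta set [D].  If [x] is in [D] and [y] in [Y], continuity of
[f (x, -)] puts [x] in the oscillation set of some neighbourhood [U] of [y];
since [x] avoids the boundary, it lies in the interior of that set, which is the
uniformity in [x] that joint continuity at [(x, y)] requires.

Conversely, suppose that dense open sets [F n] have an intersection missing a
nonempty open set [W], so that the nowhere dense closed sets [~` F n] cover [W].
Suppose given continuous functions [g n], zero on [~` F n] and nonzero on a
dense set.  Plugging them into the classical function [2 s t / (s^2 + t^2)],
which is separately but not jointly continuous at the origin, gives
[f (x, (n, t)) = 2 (g n x) t / ((g n x)^2 + t^2)], a separately continuous
function on [X * (nat * R)].  It is discontinuous at [(x, (n, 0))] for each [x]
outside [F n], hence somewhere above every point of [W], and no dense set [D] of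
points of continuity exists ([weakly_namioka_baire]).

The hypotheses on [X] serve to produce [g] for a closed nowhere dense set [C]
([zero_on_nowhere_dense]).  In both cases countably many Urysohn functions
vanishing on [C] are merged into one by a weighted supremum
([separator_bigcup]).  In a perfectly normal space [C] is a G-delta, and
Urysohn functions for the complements of the open sets that cut it out suffice.
In a separable completely regular space, one function for each point of a
countable dense set outside [C] suffices: the zero set of [g] may then be larger
than [C], but its complement is still dense. *)

Set Implicit Arguments.
Unset Strict Implicit.
Unset Printing Implicit Defensive.

Import Order.TTheory GRing.Theory Num.Theory.
Import numFieldNormedType.Exports.

Local Open Scope classical_set_scope.
Local Open Scope ring_scope.

(** * Countable intersections in Baire spaces *)

Lemma denseS (X : topologicalType) (A B : set X) :
  A `<=` B -> dense A -> dense B.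
Proof.
by move=> AB dA O O0 oO; have [x [Ox Ax]] := dA O O0 oO; exists x; split; auto.
Qed.

(** The Baire property and [Gdelta] speak of sequences; this turns a family over
a countable index set into one.  [G n] collects the at most one [F i] whose
index is numbered [n], so that it is the whole space when there is none and
openness and density pass from [F] to [G] even if [D] is empty or finite. *)
Lemma bigcap_countable_seq (T I : Type) (D : set I) (F : I -> set T) :
  countable D ->
  exists G : (set T)^nat,
    (forall n, G n = setT \/ exists2 i, D i & G n = F i) /\
    \bigcap_(i in D) F i = \bigcap_n G n.
Proof.
move=> /countable_injP[g ginj].
exists (fun n => \bigcap_(i in [set i | D i /\ g i = n]) F i); split.
  move=> n; have [[i [Di gi]]|noi] := pselect (exists i, D i /\ g i = n).
    right; exists i => //; rewrite -(bigcap_set1 F); congr bigcap.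
    apply/seteqP; split => [j [Dj gj]|j ->//]; apply: ginj; rewrite ?inE//.
    by rewrite gi gj.
  left; rewrite -subTset => x _ i Di; exfalso.
  by apply: noi; exists i.
apply/seteqP; split => [x Fx n _ i [Di _]|x Gx i Di]; first exact: Fx.
by apply: (Gx (g i)).
Qed.

Lemma baire_countable (X : topologicalType) (I : Type) (D : set I)
    (F : I -> set X) :
  baire_space X -> countable D ->
  (forall i, D i -> open (F i) /\ dense (F i)) ->
  dense (\bigcap_(i in D) F i) /\ Gdelta (\bigcap_(i in D) F i).
Proof.
move=> bX cD odF; have [G [GF ->]] := bigcap_countable_seq F cD.
have odG n : open (G n) /\ dense (G n).
  have [->|[i Di ->]] := GF n; last exact: odF.
  by split; [exact: openT | move=> O O0 _; rewrite setIT].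
split; first exact: bX.
by exists G => // n; have [] := odG n.
Qed.

(** The set [~` A `|` A°] is the complement of the boundary of [A], which for
closed [A] has empty interior: an open set contained in [A] lies in [A°]. *)
Lemma open_dense_setC_boundary (X : topologicalType) (A : set X) :
  closed A -> open (~` A `|` A°) /\ dense (~` A `|` A°).
Proof.
move=> cA; split.
  by apply: openU; [exact: closed_openC | exact: open_interior].
move=> O [x Ox] oO.
have [sOA|/existsNP[y /not_implyP[Oy nAy]]] := pselect (O `<=` A).
  by exists x; split => //; right; apply: (filterS sOA); exact: open_nbhs_nbhs.
by exists y; split => //; left.
Qed.

(** * Baire spaces are weakly Namioka *)

(** For fixed [y] and [y'] the condition is closed in [x]; it is only here that
continuity of [f] in its first variable is used along all of [U]. *)
Lemma closed_small_oscillation (R : realType) (X Y : topologicalType)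
    (Z : metricType R) (f : X * Y -> Z) (U : set Y) (e : R) :
  (forall y, continuous (fun x => f (x, y))) ->
  closed [set x | forall y y', U y -> U y' -> mdist (f (x, y)) (f (x, y')) <= e].
Proof.
move=> cf x clx y y' Uy Uy'; apply/ler_addgt0Pl => d d0.
have d20 : 0 < d / 2 by rewrite divr_gt0.
have [x' [Ax' []]] := clx _ (filterI (cvg_ball (cf y x) d20)
                                     (cvg_ball (cf y' x) d20)).
rewrite !ballEmdist /= => b1 b2.
rewrite (le_trans (metric_triangle _ (f (x', y)) _))//.
rewrite [d]splitr -addrA lerD ?(ltW b1)//.
rewrite (le_trans (metric_triangle _ (f (x', y')) _))// [leRHS]addrC lerD//.
  exact: Ax'.
by rewrite metric_sym ltW.
Qed.

(** A point off the boundaries of all sets [A (U, n)] is good: whenever it lies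
in [A (U, n)] so do its neighbours, and [f (x', y')] is compared with [f (x, y)]
through [f (x', y)]. *)
Lemma baire_weakly_namioka (R : realType) (X : topologicalType) :
  baire_space X -> weakly_namioka R X.
Proof.
move=> bX Y Z f _ [B cB [oB baseB]] [cfx cfy].
pose A (i : set Y * nat) := [set x | forall y y', i.1 y -> i.1 y' ->
  mdist (f (x, y)) (f (x, y')) <= i.2.+1%:R^-1].
have cA i : closed (A i) by exact: closed_small_oscillation.
have [dD gD] := baire_countable bX
  (countableX cB (countableP [set: nat]))
  (fun i _ => open_dense_setC_boundary (cA i)).
eexists; split; [exact: dD | exact: gD |].
move=> x y Dx; apply/metricType_numDomainType.cvgrPdist_lt => e e0.
have e20 : 0 < e / 2 by rewrite divr_gt0.
have [n] := ltr_add_invr e20; rewrite add0r => ne.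
(* Values within half of [1/(n+1)] of [f (x, y)] are within [1/(n+1)] of each
   other, which is what membership in [A (U, n)] asks. *)
have n20 : 0 < n.+1%:R^-1 / 2 :> R by rewrite divr_gt0// invr_gt0.
have [U [BU Uy] sU] := baseB y _ (cvg_ball (cfy x y) n20).
have AxU : A (U, n) x.
  move=> y1 y2 /sU + /sU; rewrite !ballEmdist /= => b1 b2.
  rewrite (le_trans (metric_triangle _ (f (x, y)) _))// [leRHS]splitr.
  by rewrite lerD// ltW// metric_sym.
have /= := Dx (U, n) (conj BU I).
case=> [//|Anx].
exists ((A (U, n))° `&` [set x' | ball (f (x, y)) (e / 2) (f (x', y))], U) => /=.
  split; last by apply: open_nbhs_nbhs; split => //; exact: oB.
  apply: filterI; first exact: (nbhs_interior Anx).
  exact: (cvg_ball (cfx y x) e20).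
case=> x' y' [/= [/interior_subset Ax' bx'] Uy'].
rewrite (le_lt_trans (metric_triangle _ (f (x', y)) _))// [ltRHS]splitr.
rewrite ltrD//; first by move: bx'; rewrite ballEmdist.
by rewrite (le_lt_trans _ ne)//; exact: Ax'.
Qed.

(** * Second countable Hausdorff products *)

Lemma second_countable_prod (Y1 Y2 : topologicalType) :
  @second_countable Y1 -> @second_countable Y2 -> @second_countable (Y1 * Y2)%type.
Proof.
move=> [B1 c1 [+ b1]] [B2 c2 [op2 b2]]; move=> op1.
exists ((fun U => U.1 `*` U.2) @` (B1 `*` B2)).
  exact: sub_countable (card_image_le _ _) (countableX c1 c2).
split=> [_ [[U1 U2] /= [/op1 oU1 /op2 oU2] <-]|[y1 y2] V [[V1 V2] /= [V1y V2y] sV]].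
  rewrite openE => -[z1 z2] /= [U1z U2z].
  by exists (U1, U2) => //; split; exact: open_nbhs_nbhs.
have [U1 [BU1 U1y] sU1] := b1 _ _ V1y.
have [U2 [BU2 U2y] sU2] := b2 _ _ V2y.
exists (U1 `*` U2); first by split => //; exists (U1, U2).
by move=> [z1 z2] [/sU1 V1z /sU2 V2z]; exact: sV.
Qed.

Lemma second_countable_nat : @second_countable nat.
Proof.
exists (range (fun n : nat => [set n])).
  exact: sub_countable (card_image_le _ _) (countableP _).
split=> [_ [n _ <-]|n V Vn]; first exact: discrete_open.
by exists [set n]; [split => //; exists n | move=> _ ->; exact: nbhs_singleton].
Qed.

Lemma second_countable_real (R : realType) : @second_countable R.
Proof.
exists (range (fun q : rat * rat => `]ratr q.1, ratr q.2[%classic : set R)).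
  exact: sub_countable (card_image_le _ _) (countableP _).
split=> [_ [q _ <-]|x V /nbhs_ballP[e /= e0 sV]].
  exact: interval_open.
have [p /itvP px] : exists q : rat, (ratr q : R) \in `]x - e, x[.
  by apply: rat_in_itvoo; rewrite ltrBlDr ltrDl.
have [q /itvP qx] : exists q : rat, (ratr q : R) \in `]x, x + e[.
  by apply: rat_in_itvoo; rewrite ltrDl.
exists `]ratr p, ratr q[%classic.
  split; first by exists (p, q).
  by rewrite /= in_itv /= px qx.
move=> y /=; rewrite in_itv /= => /andP[py yq]; apply: sV.
rewrite /ball /= distrC ltr_distl (lt_trans _ py) ?px//.
by rewrite (lt_trans yq) ?qx.
Qed.

Lemma hausdorff_prod (Y1 Y2 : topologicalType) :
  hausdorff_space Y1 -> hausdorff_space Y2 -> hausdorff_space (Y1 * Y2)%type.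
Proof.
move=> h1 h2 [p1 p2] [q1 q2] clpq; congr pair.
  apply: h1 => A B nA nB.
  have [] := clpq (fst @^-1` A) (fst @^-1` B) (cvg_fst nA) (cvg_fst nB).
  by move=> z [Az Bz]; exists z.1.
apply: h2 => A B nA nB.
have [] := clpq (snd @^-1` A) (snd @^-1` B) (cvg_snd nA) (cvg_snd nB).
by move=> z [Az Bz]; exists z.2.
Qed.

(** * A separately continuous function with prescribed discontinuities *)

(** The Genocchi-Peano function: continuous in each variable, and equal to [1] on
the punctured diagonal but [0] on the axes.  Its value at the origin is [0]
since division by zero yields zero. *)
Definition genocchi (R : fieldType) (s t : R) : R :=
  2 * s * t / (s ^+ 2 + t ^+ 2).

Lemma genocchiC (R : fieldType) (s t : R) : genocchi s t = genocchi t s.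
Proof. by rewrite /genocchi [2 * s * t]mulrAC [X in _ / X]addrC. Qed.

Lemma genocchi0 (R : fieldType) (t : R) : genocchi 0 t = 0.
Proof. by rewrite /genocchi mulr0 !mul0r. Qed.

Lemma genocchi_diag (R : numFieldType) (s : R) : s != 0 -> genocchi s s = 1.
Proof.
move=> s0; rewrite /genocchi; field.
by rewrite -mulr2n mulrn_eq0 sqrf_eq0.
Qed.

Lemma continuous_genocchi (R : realType) (s : R) : continuous (genocchi s).
Proof.
move=> t; have [->|s0] := eqVneq s 0.
  rewrite /continuous_at genocchi0 (_ : genocchi 0 = cst 0); first exact: cvg_cst.
  by apply/funext => r; rewrite genocchi0.
apply: cvgM; first by apply: cvgM; [exact: cvg_cst | exact: cvg_id].
apply: cvgV.
  by rewrite gt_eqF// ltr_pwDl ?sqr_ge0// exprn_even_gt0.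
by apply: cvgD; [exact: cvg_cst | exact: exprn_continuous].
Qed.

(** The discrete factor [nat] puts countably many functions [genocchi (g n x) t]
side by side on one second countable space, so that no series is needed. *)
Lemma separately_continuous_genocchi (R : realType) (X : topologicalType)
    (g : nat -> X -> R) :
  (forall n, continuous (g n)) ->
  separately_continuous
    (fun p : X * (nat * R) => genocchi (g p.2.1 p.1) p.2.2 : R^o).
Proof.
move=> cg; split=> [[n t] /= x|x [n t] /=].
  under eq_fun do rewrite genocchiC.
  rewrite /continuous_at.
  by apply: (cvg_comp (g n)); [exact: cg | exact: continuous_genocchi].
have nn : \forall y \near ((n, t) : nat * R), y.1 = n.
  exact: (cvg_fst (discrete_set1 n)).
apply: cvg_trans.
  apply: near_eq_cvg (fun y : nat * R => genocchi (g n x) y.2) _ _.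
  by apply: filterS nn => y /= ->.
apply: (cvg_comp snd); first exact: cvg_snd.
exact: continuous_genocchi.
Qed.

(** Near [x] there are points [x'] with [g n x'] nonzero and, by continuity, as
small as desired; taking [t := g n x'] gives points [(x', (n, t))] close to
[(x, (n, 0))] where the value is [1] instead of [0]. *)
Lemma genocchi_discontinuous (R : realType) (X : topologicalType)
    (g : nat -> X -> R) (n : nat) (x : X) :
  continuous (g n) -> g n x = 0 -> dense [set x' | g n x' != 0] ->
  ~ {for (x, (n, 0)), continuous
    (fun p : X * (nat * R) => genocchi (g p.2.1 p.1) p.2.2 : R^o)}.
Proof.
move=> cg gx0 dg /(@cvgrPdist_lt _ R^o)/(_ 1 ltr01) /=.
rewrite gx0 genocchi0.
case=> -[U W] /= [nU [[N T] /= [nN nT] sW]] sUW.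
have : nbhs x (U `&` g n @^-1` T).
  by apply: filterI => //; apply: cg; rewrite gx0.
rewrite nbhsE => -[V [oV Vx] sV].
have [x' [/sV[Ux' Tx'] /= gx']] := dg V (ex_intro _ x Vx) oV.
have /= := sUW (x', (n, g n x')) (conj Ux' (sW (n, g n x') (conj (nbhs_singleton nN) Tx'))).
by rewrite genocchi_diag// sub0r normrN normr1 ltxx.
Qed.

(** * Merging countably many Urysohn functions *)

Lemma sup_dist_le (R : realType) (v w : R^nat) (e : R) :
  has_ubound (range v) -> has_ubound (range w) ->
  (forall n, `|v n - w n| <= e) -> `|sup (range v) - sup (range w)| <= e.
Proof.
move=> bv bw vw; rewrite ler_distl; apply/andP; split.
  rewrite lerBlDr; apply: ge_sup; first by exists (w 0%N), 0%N.
  move=> _ [n _ <-].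
  have : w n <= v n + e by have := vw n; rewrite distrC ler_distl => /andP[].
  by move=> /le_trans; apply; rewrite lerD2r ub_le_sup//; exists n.
apply: ge_sup; first by exists (v 0%N), 0%N.
move=> _ [n _ <-].
have : v n <= w n + e by have := vw n; rewrite ler_distl => /andP[].
by move=> /le_trans; apply; rewrite lerD2r ub_le_sup//; exists n.
Qed.

(** A supremum of nonnegative functions is zero exactly where all of them are.
The weights [1/(n+1)] make the tail uniformly small, so that continuity of the
supremum at a point depends on finitely many [u n] only. *)
Section weighted_supremum.
Context {R : realType} {X : topologicalType} (u : nat -> X -> R).
Hypothesis u01 : forall n x, 0 <= u n x <= 1.

Definition weighted_sup (x : X) : R := sup (range (fun n => u n x / n.+1%:R)).

Let term_ge0 n x : 0 <= u n x / n.+1%:R.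
Proof. by rewrite divr_ge0//; case/andP: (u01 n x). Qed.

Let term_le n x : u n x / n.+1%:R <= n.+1%:R^-1.
Proof. by rewrite ler_piMl ?invr_ge0//; case/andP: (u01 n x). Qed.

Let has_ubound_terms x : has_ubound (range (fun n => u n x / n.+1%:R)).
Proof.
exists 1 => _ [n _ <-]; rewrite (le_trans (term_le n x))//.
by rewrite invf_le1// ler1n.
Qed.

Lemma continuous_weighted_sup :
  (forall n, continuous (u n)) -> continuous weighted_sup.
Proof.
move=> cu x; apply/cvgrPdist_le => e e0.
have [N] := ltr_add_invr e0; rewrite add0r => Ne.
have cN : \forall y \near x, forall n : 'I_N,
    `|u n x / n.+1%:R - u n y / n.+1%:R| <= e.
  apply: filter_forall => n.
  have cn : u n y / n.+1%:R @[y --> x] --> u n x / n.+1%:R.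
    by apply: cvgM; [exact: cu | exact: cvg_cst].
  exact: (@cvgrPdist_le R R^o _ _ _ _ _).1 cn e e0.
apply: filterS cN => y cN; apply: sup_dist_le => // n.
have [nN|Nn] := ltnP n N; first exact: cN (Ordinal nN).
have ne : n.+1%:R^-1 <= e.
  by rewrite (le_trans _ (ltW Ne))// lef_pV2 ?posrE// ler_nat.
rewrite ler_distl lerBlDr; apply/andP; split.
  by rewrite (le_trans (term_le n y))// (le_trans ne)// lerDr.
by rewrite (le_trans (term_le n x))// (le_trans ne)// lerDr.
Qed.

Lemma weighted_sup_eq0 x : (forall n, u n x = 0) -> weighted_sup x = 0.
Proof.
move=> u0; rewrite /weighted_sup.
suff -> : range (fun n => u n x / n.+1%:R) = [set 0] by rewrite sup1.
apply/seteqP; split => [_ [n _ <-]|_ ->]; first by rewrite u0 mul0r.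
by exists 0%N => //; rewrite u0 mul0r.
Qed.

Lemma weighted_sup_neq0 n x : u n x != 0 -> weighted_sup x != 0.
Proof.
move=> un0; rewrite gt_eqF//.
have un : 0 < u n x / n.+1%:R.
  by rewrite divr_gt0// lt_neqAle eq_sym un0; case/andP: (u01 n x).
by apply: (lt_le_trans un); apply: ub_le_sup => //; exists n.
Qed.

End weighted_supremum.

Lemma separator_bigcup (R : realType) (X : topologicalType) (C : set X)
    (P : (set X)^nat) :
  (forall n, uniform_separator C (P n)) ->
  exists g : X -> R, [/\ continuous g, forall x, C x -> g x = 0 &
    forall x, (\bigcup_n P n) x -> g x != 0].
Proof.
move=> sepP.
have /choice[u uP] n := (@uniform_separatorP _ R C (P n)).1 (sepP n).
have u01 n x : 0 <= u n x <= 1.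
  by have [_ + _ _] := uP n; move/(_ (u n x)); rewrite /= in_itv; apply; exists x.
exists (weighted_sup u); split.
- by apply: continuous_weighted_sup => // n; have [] := uP n.
- move=> x Cx; apply: weighted_sup_eq0 => n.
  by have [_ _ + _] := uP n; apply; exists x.
- move=> x [n _ Pnx]; apply: (@weighted_sup_neq0 _ _ _ u01 n).
  have [_ _ _ u1] := uP n.
  by rewrite (u1 (u n x)) ?oner_neq0//; exists x.
Qed.

(** * Functions vanishing on closed nowhere dense sets *)

(** What the converse asks of [X]: every closed nowhere dense set is contained
in a nowhere dense zero set. *)
Definition zero_on_nowhere_dense (R : realType) (X : topologicalType) :=
  forall C : set X, closed C -> dense (~` C) ->
  exists g : X -> R, [/\ continuous g, forall x, C x -> g x = 0 &
    dense [set x | g x != 0]].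

Lemma perfectly_normal_zero_on_nowhere_dense (R : realType) (X : topologicalType) :
  perfectly_normal_space X -> zero_on_nowhere_dense R X.
Proof.
move=> [nX gX] C cC dC; have [F oF CF] := gX C cC.
have sepF n : uniform_separator C (~` F n).
  apply: (@normal_separatorP R X).1 => //; first exact: open_closedC.
  by rewrite CF; apply/disjoints_subset; rewrite setCK; exact: bigcap_inf.
have [g [cg g0 gn0]] := separator_bigcup R sepF.
exists g; split => //; apply: denseS dC => x.
by rewrite CF setC_bigcap => /gn0.
Qed.

Lemma uniform_separator_sym (R : realType) (X : topologicalType) (A B : set X) :
  uniform_separator A B -> uniform_separator B A.
Proof.
move=> /(uniform_separatorP (R := R))[f [cf f01 f0 f1]].
apply/(uniform_separatorP (R := R)); exists (fun x => 1 - f x); split.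
- by move=> x; apply: (@cvgB R R^o); [exact: cvg_cst | exact: cf].
- move=> _ [x _ <-]; have := f01 (f x) (imageT f x).
  by rewrite /= !in_itv /= => /andP[f_ge0 f_le1]; apply/andP; split; lra.
- by move=> _ [x Bx <-] /=; rewrite (f1 (f x)) ?subrr//; exists x.
- by move=> _ [x Ax <-] /=; rewrite (f0 (f x)) ?subr0//; exists x.
Qed.

Lemma uniform_separator_set0r (R : realType) (X : topologicalType) (A : set X) :
  uniform_separator A set0.
Proof.
apply/(uniform_separatorP (R := R)); exists (cst 0); split.
- exact: cst_continuous.
- by move=> _ [x _ <-] /=; rewrite in_itv/= lexx ler01.
- by move=> _ [x _ <-].
- by move=> _ [x []].
Qed.

(** Points of a countable dense set [S] outside [C] are dense because the
complement of [C] is open and dense.  They are numbered by an injection [h], and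
[P n] is the singleton of the point numbered [n], or empty. *)
Lemma separable_zero_on_nowhere_dense (R : realType) (X : topologicalType) :
  completely_regular_space X -> separable_space X ->
  zero_on_nowhere_dense R X.
Proof.
move=> crX [S /countable_injP[h hinj] dS] C cC dC.
pose P n := [set s | (S `\` C) s /\ h s = n].
have sepP n : uniform_separator C (P n).
  have [[s [[Ss nCs] hs]]|noS] := pselect (exists s, P n s).
    rewrite (_ : P n = [set s]); last first.
      apply/seteqP; split => [t [[St _] ht]|t ->//]; apply: hinj; rewrite ?inE//.
      by rewrite hs ht.
    by apply/(uniform_separator_sym R)/crX.
  rewrite (_ : P n = set0); first exact: uniform_separator_set0r R _ _.
  by rewrite -subset0 => s Ps; apply: noS; exists s.
have [g [cg g0 gn0]] := separator_bigcup R sepP.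
exists g; split => //.
have := denseI (closed_openC cC) dC dS; apply: denseS => s [nCs Ss].
by apply: gn0; exists (h s).
Qed.

(** * Weakly Namioka spaces are Baire *)

Lemma weakly_namioka_baire (R : realType) (X : topologicalType) :
  zero_on_nowhere_dense R X -> weakly_namioka R X -> baire_space X.
Proof.
move=> zX wX F odF; apply: contrapT => /denseNE[W [[x0 [oW Wx0]] WF]].
have /choice[g gP] n : exists g : X -> R, [/\ continuous g,
    forall x, (~` F n) x -> g x = 0 & dense [set x | g x != 0]].
  have [oFn dFn] := odF n; apply: zX; first exact: open_closedC.
  by rewrite setCK.
have [D [dD _ cD]] := wX _ R^o _
  (hausdorff_prod (discrete_hausdorff : hausdorff_space nat) (@Rhausdorff R))
  (second_countable_prod second_countable_nat (@second_countable_real R))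
  (separately_continuous_genocchi (fun n => let: And3 cg _ _ := gP n in cg)).
have [x [Wx Dx]] := dD W (ex_intro _ x0 Wx0) oW.
have [n nFx] : exists n, ~ F n x.
  apply/existsNP => Fx; have : (W `&` \bigcap_i F i) x by split => // n _.
  by rewrite WF.
have [cg g0 gd] := gP n.
exact: (genocchi_discontinuous cg (g0 x nFx) gd) (cD x (n, 0) Dx).
Qed.

Theorem theorem2p5 (R : realType) (X : topologicalType) :
  hausdorff_space X ->
  (completely_regular_space X /\ separable_space X) \/
    perfectly_normal_space X ->
  (baire_space X <-> weakly_namioka R X).
Proof.
move=> _ hX; split; first exact: baire_weakly_namioka.
apply: weakly_namioka_baire; case: hX => [[]|].
  exact: separable_zero_on_nowhere_dense.
exact: perfectly_normal_zero_on_nowhere_dense.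
Qed.
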